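(* Let $n_1,n_2, \ldots, n_l \geq 1$ be integers, let $F_1, F_2, \ldots, F_l$ be finite fields, and let $R=M_{n_1}(F_1) \times M_{n_2}(F_2) \times \cdots \times M_{n_l}(F_l)$. Then $$C_W(\Gamma(R))\leq \prod_{i=1}^{l}n_i + \prod_{i=1}^{l}(n_i+1) -3.$$
   Context: $M_n(F)$ is the ring of all $n\times n$ matrices with entries in $F$. For a finite ring $R$ (possibly non-commutative), $Z(R)=\{x \in R : \text{there exists } 0 \neq y \in R \text{ such that } xy=0 \text{ or } yx=0\}$ is the set of zero-divisors. The zero-divisor graph $\Gamma(R)$ is the undirected simple graph with vertex set $V(\Gamma(R))=Z(R)\setminus\{0\}$ in which two distinct vertices $x \neq y$ are joined by an edge if and only if $xy=0$ or $yx=0$. $d(u,v)$ denotes the distance (length of a shortest path) between vertices $u$ and $v$. The transmission of a vertex $u$ of a graph $\Gamma$ is $\mathrm{Tr}(u)=\sum_{v\in V(\Gamma)}d(u,v)$. The Wiener complexity $C_W(\Gamma)$ is the number of different values taken by $\mathrm{Tr}(u)$ as $u$ ranges over $V(\Gamma)$. *)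

(* Defs.v *)
From HB Require Import structures.
From mathcomp Require Import all_boot all_order all_algebra.

Set Implicit Arguments.
Unset Strict Implicit.
Unset Printing Implicit Defensive.

Import GRing.Theory.
Local Open Scope ring_scope.

Section GraphDistance.
Variables (V : finType) (e : rel V).

Definition has_walk (u v : V) (k : nat) : bool :=
  [exists p : k.-tuple V, path e u p && (last u p == v)].

(* A shortest path has at most #|V| - 1 edges, so searching k < #|V| is enough;
   the value is #|V| when v is not reachable from u. *)
Definition gdist (u v : V) : nat := find (has_walk u v) (iota 0 #|V|).

Lemma gdist_path (u : V) (p : seq V) :
  path e u p -> (gdist u (last u p) <= size p)%N.
Proof.
move=> ep; rewrite leqNgt; apply/negP => lt_p.
have lt_pV : (size p < #|V|)%N.
  by apply: leq_trans lt_p _; rewrite -[leqRHS](size_iota 0) find_size.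
have := before_find 0%N lt_p; rewrite nth_iota // add0n.
by move/negbT/existsP; apply; exists (in_tuple p); rewrite ep /=.
Qed.

Lemma gdist_connect (u v : V) :
  connect e u v -> exists p, [/\ path e u p, v = last u p & size p = gdist u v].
Proof.
case/connectP=> p0 /shortenP[p ep Up _] def_v.
have lt_pV : (size p < #|V|)%N by rewrite -[(size p).+1]/(size (u :: p)) -(card_uniqP Up) max_card.
have: has (has_walk u v) (iota 0 #|V|).
  apply/hasP; exists (size p); first by rewrite mem_iota.
  by apply/existsP; exists (in_tuple p); rewrite ep def_v /=.
move=> Hw; have := nth_find 0%N Hw; rewrite has_find size_iota in Hw.
rewrite nth_iota // add0n => /existsP[q /andP[eq /eqP def_q]].
by exists q; rewrite eq size_tuple.
Qed.

Definition transmission (u : V) : nat := (\sum_(v : V) gdist u v)%N.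

Definition wiener_complexity : nat :=
  size (undup [seq transmission u | u : V]).

End GraphDistance.

Section ZeroDivisorGraph.
Variable R : finPzRingType.

Definition zero_divisor (x : R) : bool :=
  [exists y : R, (y != 0) && ((x * y == 0) || (y * x == 0))].

Definition zd_vertex : finType := {x : R | zero_divisor x && (x != 0)}.

Definition zd_adj : rel zd_vertex := fun x y =>
  (x != y) && ((val x * val y == 0) || (val y * val x == 0)).

End ZeroDivisorGraph.

Section ProductRing.
Variables (I : finType) (R : I -> finPzRingType).

Definition prod_ring : Type := {dffun forall i : I, R i}.

HB.instance Definition _ := Finite.on prod_ring.

Implicit Types x y z : prod_ring.

Definition prod_zero : prod_ring := [ffun i : I => (0 : R i)].
Definition prod_one : prod_ring := [ffun i : I => (1 : R i)].
Definition prod_opp x : prod_ring := [ffun i : I => - x i].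
Definition prod_add x y : prod_ring := [ffun i : I => x i + y i].
Definition prod_mul x y : prod_ring := [ffun i : I => x i * y i].

Fact prod_addA : associative prod_add.
Proof. by move=> x y z; apply/ffunP => i; rewrite !ffunE addrA. Qed.
Fact prod_addC : commutative prod_add.
Proof. by move=> x y; apply/ffunP => i; rewrite !ffunE addrC. Qed.
Fact prod_add0 : left_id prod_zero prod_add.
Proof. by move=> x; apply/ffunP => i; rewrite !ffunE add0r. Qed.
Fact prod_addN : left_inverse prod_zero prod_opp prod_add.
Proof. by move=> x; apply/ffunP => i; rewrite !ffunE addNr. Qed.

HB.instance Definition _ :=
  GRing.isZmodule.Build prod_ring prod_addA prod_addC prod_add0 prod_addN.

Fact prod_mulA : associative prod_mul.
Proof. by move=> x y z; apply/ffunP => i; rewrite !ffunE mulrA. Qed.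
Fact prod_mul1 : left_id prod_one prod_mul.
Proof. by move=> x; apply/ffunP => i; rewrite !ffunE mul1r. Qed.
Fact prod_mulr1 : right_id prod_one prod_mul.
Proof. by move=> x; apply/ffunP => i; rewrite !ffunE mulr1. Qed.
Fact prod_mulDl : left_distributive prod_mul +%R.
Proof. by move=> x y z; apply/ffunP => i; rewrite !ffunE mulrDl. Qed.
Fact prod_mulDr : right_distributive prod_mul +%R.
Proof. by move=> x y z; apply/ffunP => i; rewrite !ffunE mulrDr. Qed.

HB.instance Definition _ := GRing.Zmodule_isPzRing.Build prod_ring
  prod_mulA prod_mul1 prod_mulr1 prod_mulDl prod_mulDr.

End ProductRing.

(* 'M[R]_n carries both canonical structures for variable n, but their join is
   canonical only at sizes n.+1; pz because 'M[R]_0 is the zero ring. *)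
Definition mx_ring (R : finPzRingType) (n : nat) : finPzRingType :=
  HB.pack 'M[R]_n (GRing.PzRing.on 'M[R]_n) (Finite.on 'M[R]_n).

(* Main.v *)
Require Import Defs.
From mathcomp Require Import all_boot all_order all_algebra.

(** Two vertices u != v are adjacent when uv = 0 or vu = 0; otherwise they are
    at distance 2 when uw = 0 = wv for some w != 0, and at distance 3 if not.
    Multiplying u by units, u' = P u Q, and transporting v to Q^-1 v P^-1
    preserves both conditions, so the sum of the separations of u from all
    vertices depends only on the ranks of the components of u.  The
    transmission removes the term v = u from that sum, which is 1 or 2
    according to whether u^2 = 0.  There are prod (n_i + 1) - 2 rank vectors of
    vertices, and u^2 = 0 forces every rank to be below n_i, which leaves at
    most prod n_i - 1 nonzero rank vectors for the second case. *)

Set Implicit Arguments.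
Unset Strict Implicit.
Unset Printing Implicit Defensive.

(** * Distances and transmissions in a ring with well-placed common annihilators *)

Section AbstractTransmission.
Import GRing.Theory.
Local Open Scope ring_scope.
Variable R : finPzRingType.
Implicit Types x y w : R.

Definition orth x y := (x * y == 0) || (y * x == 0).
Definition linked x y := [exists w, [&& w != 0, x * w == 0 & w * y == 0]].
(** Equals the distance off the diagonal but is not 0 on it, so that sums over all vertices need no
    exception at [v = x]. *)
Definition separation x y : nat :=
  if orth x y then 1 else if linked x y then 2 else 3.

Lemma linkedP x y :
  reflect (exists w, [/\ w != 0, x * w = 0 & w * y = 0]) (linked x y).
Proof.
apply: (iffP existsP) => -[w]; first by case/and3P=> ? /eqP? /eqP?; exists w.
by case=> w0 xw wy; exists w; rewrite w0 xw wy eqxx.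
Qed.

Lemma zero_divisorP x :
  reflect (exists2 y, y != 0 & orth x y) (zero_divisor x).
Proof.
by apply: (iffP existsP) => -[y]; [case/andP; exists y | exists y; apply/andP].
Qed.

Lemma orthC x y : orth x y = orth y x. Proof. exact: orbC. Qed.

Lemma orthMl x y : x * y = 0 -> orth x y.
Proof. by move=> xy; rewrite /orth xy eqxx. Qed.

Lemma orthMr x y : y * x = 0 -> orth x y.
Proof. by rewrite orthC; apply: orthMl. Qed.

(** Whatever sides [w] annihilates [x] and [y] on, a witness for the fixed sides of [linked] exists.
    Products of matrix rings satisfy this by [prod_mx_common_annihilator]. *)
Hypothesis common_annihilator : forall x y w,
  w != 0 -> orth x w -> orth y w -> linked x y.

Lemma linked_refl x : zero_divisor x -> linked x x.
Proof. by case/zero_divisorP=> w w0 xw; apply: (common_annihilator w0). Qed.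

Lemma separation_refl x :
  zero_divisor x -> separation x x = if x * x == 0 then 1%N else 2.
Proof. by move=> zx; rewrite /separation /orth orbb linked_refl. Qed.

Lemma vertexP x w : x != 0 -> w != 0 -> orth x w ->
  exists u : zd_vertex R, val u = x.
Proof.
move=> x0 w0 xw; have Px : zero_divisor x && (x != 0).
  by rewrite x0 andbT; apply/zero_divisorP; exists w.
by exists (exist _ x Px).
Qed.

Lemma zd_adjE (u v : zd_vertex R) :
  zd_adj u v = (u != v) && orth (val u) (val v).
Proof. by []. Qed.

Lemma gdist_le2 (u v : zd_vertex R) : linked (val u) (val v) ->
  connect (@zd_adj R) u v /\ (gdist (@zd_adj R) u v <= 2)%N.
Proof.
have u0 : val u != 0 by case/andP: (valP u).
case/linkedP=> w [w0 uw wv].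
have [c def_c] := vertexP w0 u0 (orthMr uw).
have [->|neq_uv] := eqVneq u v.
  by split; [apply: connect0 | apply: leq_trans (gdist_path (p := [::]) _) _].
have [auv|nauv] := boolP (orth (val u) (val v)).
  have p1 : path (@zd_adj R) u [:: v] by rewrite /= zd_adjE neq_uv auv.
  split; last exact: leq_trans (gdist_path p1) _.
  by apply/connectP; exists [:: v].
have p2 : path (@zd_adj R) u [:: c; v].
  rewrite /= !zd_adjE def_c (orthMl uw) (orthMl wv) !andbT.
  (* If [c] coincided with [u] or [v], then [u] and [v] would be orthogonal. *)
  by apply/andP; split; apply: contraNneq nauv => e;
    [rewrite e def_c orthMl | rewrite -e def_c orthMl].
by split; [apply/connectP; exists [:: c; v] | apply: gdist_path p2].
Qed.

Lemma gdist_le3 (u v : zd_vertex R) :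
  connect (@zd_adj R) u v /\ (gdist (@zd_adj R) u v <= 3)%N.
Proof.
have [/gdist_le2[? /leqW ?]//|nuv] := boolP (linked (val u) (val v)).
have [/andP[zu u0] /andP[zv v0]] := (valP u, valP v).
have /linkedP[a [a0 ua au]] := linked_refl zu.
have /linkedP[b [b0 vb bv]] := linked_refl zv.
(* If ab were nonzero, it would link u and v. *)
have ab : a * b = 0.
  apply: contraNeq nuv => ab0; apply/linkedP; exists (a * b).
  by rewrite mulrA ua mul0r -mulrA bv mulr0.
have nlink w : w != 0 -> orth (val u) w -> orth (val v) w -> False.
  by move=> w0 uw vw; move/negP: nuv; apply; apply: common_annihilator uw vw.
have [c def_c] := vertexP a0 u0 (orthMr ua).
have [d def_d] := vertexP b0 v0 (orthMl bv).
have p3 : path (@zd_adj R) u [:: c; d; v].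
  rewrite /= !zd_adjE def_c def_d (orthMl ua) (orthMl ab) (orthMl bv) !andbT.
  (* Any coincidence of consecutive vertices makes [a] or [b] annihilate both [u] and [v], against
     [nlink]. *)
  apply/and3P; split; apply/eqP => e.
  - by apply: (nlink b) => //; [rewrite e def_c orthMl | rewrite orthMl].
  - by apply: (nlink a); rewrite ?orthMl // -def_c e def_d.
  - by apply: (nlink a); rewrite ?(orthMl ua) // -e def_d orthMr.
by split; [apply/connectP; exists [:: c; d; v] | apply: gdist_path p3].
Qed.

Lemma gdistE (u v : zd_vertex R) :
  gdist (@zd_adj R) u v = if u == v then 0%N else separation (val u) (val v).
Proof.
have [conn le3] := gdist_le3 u v.
have [<-|neq_uv] := eqVneq u v.
  by apply/eqP; rewrite -leqn0; apply: (gdist_path (p := [::])).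
have [p [ep def_v sz_p]] := gdist_connect conn.
rewrite /separation; case: ifPn => [uv|nuv].
  have p1 : path (@zd_adj R) u [:: v] by rewrite /= zd_adjE neq_uv uv.
  have := gdist_path p1; rewrite /= -sz_p.
  by case: p {sz_p} ep def_v => [|c [|d p]] //= _ def_v;
    rewrite def_v eqxx in neq_uv.
case: ifPn => [/gdist_le2[_]|nlink].
  rewrite -sz_p; case: p {sz_p} ep def_v => [|c [|d [|e p]]] //=.
    by move=> _ def_v; rewrite def_v eqxx in neq_uv.
  by rewrite zd_adjE andbT => /andP[_ uc] def_v; rewrite def_v uc in nuv.
move: le3; rewrite -sz_p; case: p {sz_p} ep def_v => [|c [|d [|e [|f p]]]] //=.
- by move=> _ def_v; rewrite def_v eqxx in neq_uv.
- by rewrite zd_adjE andbT => /andP[_ uc] def_v; rewrite def_v uc in nuv.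
(* Length 2 remains to be excluded: the middle vertex would link [u] and [v]. *)
rewrite !zd_adjE andbT => /andP[/andP[_ uc] /andP[_ cd]] def_v.
have /andP[_ c0] := valP c.
by rewrite def_v (common_annihilator c0 uc) // orthC in nlink.
Qed.

(** The added term is the separation of [u] from itself, where the distance is 0; keeping it on the
    left avoids truncated subtraction. *)
Lemma transmissionE (u : zd_vertex R) :
  (transmission (@zd_adj R) u + (if (val u * val u == 0)%R then 1 else 2)
   = \sum_(v | zero_divisor v && (v != 0%R)) separation (val u) v)%N.
Proof.
have /andP[zu _] := valP u.
rewrite -separation_refl // (big_sub [pred v | zero_divisor v && (v != 0)]) /=.
rewrite /transmission (bigD1 u) //= [RHS](bigD1 u) //= gdistE eqxx add0n addnC.
congr (_ + _)%N; apply: eq_bigr => v; rewrite gdistE eq_sym.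
by move/negPf=> ->.
Qed.

(** * Invariance under multiplication by units *)

Lemma mulK1 (A A' B B' x : R) :
  A' * A = 1 -> B * B' = 1 -> A' * (A * x * B) * B' = x.
Proof. by move=> A'A BB'; rewrite !mulrA A'A mul1r -mulrA BB' mulr1. Qed.

Lemma mulK1_eq0 (A A' B B' x : R) :
  A' * A = 1 -> B * B' = 1 -> (A * x * B == 0) = (x == 0).
Proof.
move=> A'A BB'; apply/eqP/eqP=> [AxB|->]; last by rewrite mulr0 mul0r.
by rewrite -(mulK1 x A'A BB') AxB mulr0 mul0r.
Qed.

Lemma orth_equiv (P P' Q Q' x y : R) : P' * P = 1 -> Q * Q' = 1 ->
  orth (P * x * Q) (Q' * y * P') = orth x y.
Proof.
move=> P'P QQ'; rewrite /orth.
have -> : P * x * Q * (Q' * y * P') = P * (x * y) * P'.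
  by rewrite !mulrA -(mulrA _ Q) QQ' mulr1.
have -> : Q' * y * P' * (P * x * Q) = Q' * (y * x) * Q.
  by rewrite !mulrA -(mulrA _ P') P'P mulr1.
by rewrite (mulK1_eq0 _ P'P P'P) (mulK1_eq0 _ QQ' QQ').
Qed.

(** The annihilator [w] is conjugated to [Q' * w * Q], so that the inner factors [Q * Q'] cancel. *)
Lemma linked_equiv_sub (P P' Q Q' x y : R) : P' * P = 1 -> Q * Q' = 1 ->
  linked x y -> linked (P * x * Q) (Q' * y * P').
Proof.
move=> P'P QQ' /linkedP[w [w0 xw wy]]; apply/linkedP; exists (Q' * w * Q).
rewrite (mulK1_eq0 _ QQ' QQ') w0; split=> //.
  by rewrite !mulrA -(mulrA _ Q) QQ' mulr1 -(mulrA P) xw mulr0 mul0r.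
by rewrite !mulrA -(mulrA _ Q) QQ' mulr1 -(mulrA Q') wy mulr0 mul0r.
Qed.

Section EquivalenceInvariance.
Variables P P' Q Q' : R.
Hypotheses (PP' : P * P' = 1) (P'P : P' * P = 1).
Hypotheses (QQ' : Q * Q' = 1) (Q'Q : Q' * Q = 1).

Lemma linked_equiv x y : linked (P * x * Q) (Q' * y * P') = linked x y.
Proof.
apply/idP/idP; last exact: linked_equiv_sub.
by move/(linked_equiv_sub PP' Q'Q); rewrite !mulK1.
Qed.

Lemma zero_divisor_equiv y : zero_divisor (Q' * y * P') = zero_divisor y.
Proof.
apply/zero_divisorP/zero_divisorP=> -[w w0 yw].
  exists (P' * w * Q'); first by rewrite (mulK1_eq0 _ PP' Q'Q).
  by rewrite orthC -(orth_equiv _ _ P'P QQ') mulK1 // orthC.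
exists (P * w * Q); first by rewrite (mulK1_eq0 _ P'P QQ').
by rewrite orthC orth_equiv // orthC.
Qed.

(** The bijection sending [v] to [Q' * v * P'] permutes the vertices and compensates for the change
    of [x] in every term. *)
Lemma separation_sum_equiv x :
  (\sum_(v | zero_divisor v && (v != 0%R)) separation (P * x * Q)%R v
   = \sum_(v | zero_divisor v && (v != 0%R)) separation x v)%N.
Proof.
rewrite (reindex_inj (h := fun v => (Q' * v * P')%R)) /=; last first.
  by apply: (can_inj (g := fun v => (Q * v * P)%R)) => v; rewrite mulK1.
by apply: eq_big => v; rewrite ?zero_divisor_equiv ?(mulK1_eq0 _ QQ' P'P) //
   /separation orth_equiv // linked_equiv.
Qed.

(** The condition on squares equates the diagonal corrections; equivalence alone does not, as the
    matrix units [E_12] and [E_11] show. *)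
Lemma transmission_equiv (u u' : zd_vertex R) :
  val u' = P * val u * Q -> (val u' * val u' == 0) = (val u * val u == 0) ->
  transmission (@zd_adj R) u' = transmission (@zd_adj R) u.
Proof.
move=> def_u' sq; have := transmissionE u'.
rewrite sq def_u' separation_sum_equiv -transmissionE.
exact: addIn.
Qed.

End EquivalenceInvariance.
End AbstractTransmission.

(** * Annihilators and ranks in products of matrix rings *)

Section MatrixProduct.
Import GRing.Theory.
Local Open Scope ring_scope.

Lemma mul_coker_ker_neq0 (K : fieldType) (m : nat) (A B : 'M[K]_m) :
  A \notin unitmx -> B \notin unitmx ->
  exists W : 'M_m, [/\ W != 0, A *m W = 0 & W *m B = 0].
Proof.
move=> nA nB.
have: cokermx A != 0 by rewrite cokermx_eq0 row_full_unit.
have: kermx B != 0 by rewrite kermx_eq0 row_free_unit.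
case/matrix0Pn=> i [b Bib] /matrix0Pn[a [j Aaj]].
(* A column of the cokernel times a row of the kernel: entry [(a, b)] is the product of the two
   nonzero entries found above. *)
exists (cokermx A *m delta_mx j i *m kermx B); split.
- apply/matrix0Pn; exists a, b.
  by rewrite -(mul_delta_mx (0 : 'I_1)) mulmxA -colE -mulmxA -rowE mxE big_ord1
    [col _ _ _ _]mxE [row _ _ _ _]mxE mulf_neq0.
- by rewrite mulmxA [A *m (_ *m _)]mulmxA mulmx_coker !mul0mx.
- by rewrite -mulmxA mulmx_ker mulmx0.
Qed.

Lemma mulmx_eq0_notin_unitmx (K : fieldType) (m : nat) (A W : 'M[K]_m) :
  W != 0 -> (A *m W == 0) || (W *m A == 0) -> A \notin unitmx.
Proof.
move=> W0 AW; apply: contraNN W0 => uA.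
case/orP: AW => /eqP AW; first by rewrite -(mulKmx uA W) AW mulmx0.
by rewrite -(mulmxK uA W) AW mul0mx.
Qed.

(** Gaussian elimination brings both matrices to the same [pid_mx]; [P] and [Q] exchange the two
    pairs of extended bases. *)
Lemma rank_equivalent (K : fieldType) (m : nat) (A B : 'M[K]_m) :
  \rank A = \rank B ->
  exists P Q : 'M_m, [/\ P \in unitmx, Q \in unitmx & B = P *m A *m Q].
Proof.
move=> rAB.
exists (col_ebase B *m invmx (col_ebase A)), (invmx (row_ebase A) *m row_ebase B).
rewrite !unitmx_mul !unitmx_inv !col_ebase_unit !row_ebase_unit; split=> //.
rewrite -{2}(mulmx_ebase A) !mulmxA mulmxKV ?col_ebase_unit //.
by rewrite mulmxK ?row_ebase_unit // rAB mulmx_ebase.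
Qed.

Variables (l : nat) (n : 'I_l -> nat) (F : 'I_l -> finFieldType).
Let R := prod_ring (fun i : 'I_l => mx_ring (F i) (n i)).
Implicit Types x y w : R.

(** The index depends on [w] alone, so two elements orthogonal to [w] are singular in the same
    component. *)
Lemma orth_singular w : w != 0 ->
  exists i, forall x, orth x w -> (x i : 'M_(n i)) \notin unitmx.
Proof.
move=> w0; have /existsP[i wi0] : [exists i, w i != 0].
  apply: contraNT w0 => /existsPn wi0.
  by apply/eqP/ffunP => i; rewrite ffunE; apply/eqP/negPn/wi0.
exists i => x xw; apply: mulmx_eq0_notin_unitmx wi0 _.
by case/orP: xw => /eqP/ffunP/(_ i); rewrite !ffunE => xw;
  apply/orP; [left | right]; apply/eqP.
Qed.

Lemma prod_mx_common_annihilator x y w :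
  w != 0 -> orth x w -> orth y w -> linked x y.
Proof.
move=> /orth_singular[i sing] xw yw.
have [W [W0 xW Wy]] := mul_coker_ker_neq0 (sing x xw) (sing y yw).
pose z : R := [ffun j => dfwith (fun k => 0 : mx_ring (F k) (n k)) W j].
apply/linkedP; exists z; split.
- apply: contraNneq W0 => /ffunP/(_ i); rewrite !ffunE dfwith_in => ->.
  exact: eqxx.
- apply/ffunP => j; rewrite !ffunE.
  by case: dfwithP => [|k _]; [exact: xW | rewrite mulr0].
- apply/ffunP => j; rewrite !ffunE.
  by case: dfwithP => [|k _]; [exact: Wy | rewrite mul0r].
Qed.

(** A finite codomain allows counting; [inord] never falls back to its default, since a rank is at
    most [n i]. *)
Definition rank_vector x : {dffun forall i : 'I_l, 'I_(n i).+1} :=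
  [ffun i => inord (\rank (x i : 'M_(n i)))].

Lemma rank_vectorE x i : rank_vector x i = \rank (x i : 'M_(n i)) :> nat.
Proof. by rewrite ffunE inordK // ltnS rank_leq_row. Qed.

Lemma rank_vector_eq0 x : (rank_vector x == [ffun=> ord0]) = (x == 0).
Proof.
apply/eqP/eqP => [/ffunP rx0|->]; last first.
  by apply/ffunP => i; apply: ord_inj; rewrite rank_vectorE !ffunE /= mxrank0.
apply/ffunP => i; apply/eqP; rewrite ffunE -[_ == _]mxrank_eq0.
by rewrite -rank_vectorE rx0 ffunE.
Qed.

Lemma rank_vector_full x : zero_divisor x -> rank_vector x != [ffun=> ord_max].
Proof.
case/zero_divisorP=> w w0 xw; apply/eqP => /ffunP fx.
have [i /(_ x xw)] := orth_singular w0.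
by rewrite -row_free_unit /row_free -rank_vectorE fx ffunE eqxx.
Qed.

(** A vanishing square bounds twice the rank by [n i], which excludes full rank when [n i] is
    positive. *)
Lemma rank_vector_sqr0 x i :
  (0 < n i)%N -> x * x = 0 -> (rank_vector x i < n i)%N.
Proof.
move=> ni0 /ffunP/(_ i); rewrite rank_vectorE !ffunE => xx.
rewrite ltn_neqAle rank_leq_row andbT.
apply: contraTneq ni0 => rx.
have := mulmx0_rank_max (xx : (x i : 'M_(n i)) *m x i = 0).
by rewrite rx -{3}[n i]addn0 leq_add2l -leqNgt.
Qed.

Lemma transmission_rank_vector (u u' : zd_vertex R) :
  rank_vector (val u) = rank_vector (val u') ->
  (val u * val u == 0) = (val u' * val u' == 0) ->
  transmission (@zd_adj R) u = transmission (@zd_adj R) u'.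
Proof.
move=> ruu' sq.
(* The boolean form lets [xchoose] pick units in all components at once. *)
have PQ i : exists pq : 'M[F i]_(n i) * 'M_(n i),
    [&& pq.1 \in unitmx, pq.2 \in unitmx &
       (val u' i : 'M_(n i)) == pq.1 *m val u i *m pq.2].
  have [] := @rank_equivalent _ _ (val u i : 'M_(n i)) (val u' i : 'M_(n i)).
    by rewrite -!rank_vectorE ruu'.
  by move=> p [q [p_unit q_unit ->]]; exists (p, q); rewrite p_unit q_unit /=.
pose p i := (xchoose (PQ i)).1; pose q i := (xchoose (PQ i)).2.
have pqP i : [/\ p i \in unitmx, q i \in unitmx
    & val u' i = p i *m val u i *m q i].
  by have /and3P[? ? /eqP] := xchooseP (PQ i).
apply/esym/(@transmission_equiv R prod_mx_common_annihilator
  [ffun i => p i] [ffun i => invmx (p i)]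
  [ffun i => q i] [ffun i => invmx (q i)]) => //;
  apply/ffunP => i; have [p_unit q_unit def_u'] := pqP i; rewrite !ffunE //.
- exact: mulmxV.
- exact: mulVmx.
- exact: mulmxV.
- exact: mulVmx.
Qed.

End MatrixProduct.

(** * Counting values through rank vectors *)

Lemma size_undup_image_le (V T : finType) (f : V -> nat) (g : V -> T)
    (S : {set T}) :
  (forall u v, g u = g v -> f u = f v) -> (forall u, g u \in S) ->
  size (undup [seq f u | u : V]) <= #|S|.
Proof.
(* [h] factors [f] through [g]; its default 0 is taken only outside the image of [g]. *)
move=> fg gS; pose h t := if [pick u | g u == t] is Some u then f u else 0.
rewrite cardE -(size_map h); apply: uniq_leq_size (undup_uniq _) _ => k.
rewrite mem_undup => /mapP[u _ ->]; apply/mapP; exists (g u).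
  by rewrite mem_enum.
by rewrite /h; case: pickP => [v /eqP/fg //|/(_ u)]; rewrite eqxx.
Qed.

Lemma card_dffun_ord (l : nat) (n : 'I_l -> nat) :
  #|{dffun forall i : 'I_l, 'I_(n i).+1}| = \prod_(i < l) (n i).+1.
Proof.
rewrite card_dep_ffun foldrE big_image.
by apply: eq_bigr => i _; rewrite card_ord.
Qed.

Lemma card_dffun_ord_ltn (l : nat) (n : 'I_l -> nat) :
  #|[set r : {dffun forall i : 'I_l, 'I_(n i).+1} | [forall i, r i < n i]]|
    = \prod_(i < l) n i.
Proof.
pose D i (k : 'I_(n i).+1) := k < n i.
have /eq_card -> : [set r : {dffun forall i : 'I_l, 'I_(n i).+1} |
    [forall i, r i < n i]] =i family D.
  by move=> r; rewrite inE; apply/forallP/familyP.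
rewrite card_family foldrE big_image; apply: eq_bigr => i _.
rewrite -[RHS]card_ord; apply/eqP.
(* The ordinals below [n i] form the image of ['I_(n i)] in ['I_(n i).+1]. *)
have widen_inj : injective (widen_ord (leqnSn (n i))).
  by move=> j k /(congr1 val) /= /val_inj.
rewrite -(card_codom widen_inj); apply/eqP/eq_card => k.
apply/idP/codomP => [kn|[j ->]]; last exact: (ltn_ord j).
by exists (Ordinal kn); apply: val_inj.
Qed.

Theorem theorem4 (l : nat) (hl : (0 < l)%N)
    (n : 'I_l -> nat) (hn : forall i : 'I_l, (1 <= n i)%N)
    (F : 'I_l -> finFieldType) :
  (wiener_complexity
     (@zd_adj (prod_ring (fun i : 'I_l => mx_ring (F i) (n i))))
   <= \prod_(i < l) n i + \prod_(i < l) (n i).+1 - 3)%N.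
Proof.
pose T := {dffun forall i : 'I_l, 'I_(n i).+1}.
pose zero : T := [ffun=> ord0]; pose full : T := [ffun=> ord_max].
pose A := ~: [set zero; full].
pose B := [set r : T | [forall i, r i < n i]] :\ zero.
(* They differ in the first component, which exists by [hl] and has positive size by [hn]; hence [A]
   omits exactly two vectors. *)
have neq_zf : zero != full.
  apply/eqP => /ffunP/(_ (Ordinal hl)); rewrite !ffunE => /(congr1 val) /= n0.
  by have := hn (Ordinal hl); rewrite -n0.
have cardA : #|A| + 2 = \prod_(i < l) (n i).+1.
  by rewrite -card_dffun_ord -(cardsC [set zero; full]) cards2 neq_zf addnC.
have cardB : #|B| + 1 = \prod_(i < l) n i.
  have zero_in : zero \in [set r : T | [forall i, r i < n i]].
    by rewrite inE; apply/forallP => i; rewrite ffunE; apply: hn.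
  by rewrite -card_dffun_ord_ltn [RHS](cardsD1 zero) zero_in addnC.
rewrite -cardA -cardB.
(* The 3 collects the two vectors missing from [A] and the zero vector missing from [B]. The boolean
   tag records whether the square vanishes. *)
have -> : #|B| + 1 + (#|A| + 2) - 3
    = #|setX A [set false]| + #|setX B [set true]|.
  by rewrite !cardsX !cards1 !muln1 addnACA addnK addnC.
apply: leq_trans (leq_card_setU _ _).
pose g (u : zd_vertex (prod_ring (fun i : 'I_l => mx_ring (F i) (n i)))) :=
  (rank_vector (val u), val u * val u == 0)%R.
apply: (size_undup_image_le (g := g)) => [u v [] | u].
  exact: transmission_rank_vector.
have /andP[zu u0] := valP u.
rewrite !inE /= -/zero -/full /zero rank_vector_eq0 (negPf u0) /=.
rewrite (negPf (rank_vector_full zu)) /=.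
case: ((sval u * sval u)%R =P 0%R) => [sq|//].
rewrite andbT; apply/forallP => i.
exact: rank_vector_sqr0 (hn i) sq.
Qed.
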